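(* Let $q\ge 2$ and $n\ge 1$ be integers, and let $C(n,q)$ denote the maximum size of a cross-bifix-free code in $\mathbb Z_q^n$. Then $$C(n,q)\le\frac{q^n}{2n-1}.$$
   Context: Let $\mathbb Z_q=\{0,\dots,q-1\}$. For a word $\mathbf u\in\mathbb Z_q^n$, a word $\mathbf v$ is a prefix (resp. suffix) of $\mathbf u$ if $\mathbf u=(\mathbf v,\mathbf w)$ (resp. $\mathbf u=(\mathbf w,\mathbf v)$) for some word $\mathbf w$; only nonempty prefixes and suffixes of length strictly less than $n$ are considered. A cross-bifix-free code is a set of words in $\mathbb Z_q^n$ such that no prefix (of any length) of any word in the set is a suffix of any word in the set, including the word itself. *)

(* Defs.v *)
From mathcomp Require Import all_boot all_order all_algebra.

Set Implicit Arguments.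
Unset Strict Implicit.
Unset Printing Implicit Defensive.

Section CrossBifixFree.

Variable T : finType.

Definition proper_prefix (v u : seq T) : bool :=
  [&& v != [::], size v < size u & prefix v u].

Definition proper_suffix (v u : seq T) : bool :=
  [&& v != [::], size v < size u & suffix v u].

(* The words u and w need not be distinct. The word v ranges over the lengths
   k < n only to keep the predicate boolean; cross_bifix_freeP below shows that
   this is the condition over all words v. *)
Definition cross_bifix_free (n : nat) (S : {set n.-tuple T}) : bool :=
  [forall u in S, forall w in S, forall k : 'I_n, forall v : k.-tuple T,
     ~~ (proper_prefix v u && proper_suffix v w)].

Lemma cross_bifix_freeP (n : nat) (S : {set n.-tuple T}) :
  reflect (forall (u w : n.-tuple T) (v : seq T), u \in S -> w \in S ->
             ~ (proper_prefix v u /\ proper_suffix v w))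
          (cross_bifix_free S).
Proof.
apply: (iffP forall_inP) => [cbf u w v uS wS [pv sv]|cbf u uS].
  have lt_v_n : size v < n by case/and3P: pv => _; rewrite size_tuple.
  move/forall_inP: (cbf u uS) => /(_ w wS)/forallP/(_ (Ordinal lt_v_n)).
  by move/forallP/(_ (in_tuple v)); rewrite /= pv sv.
apply/forall_inP => w wS; apply/forallP => k; apply/forallP => v.
by apply/negP => /andP pv; apply: (cbf u w v uS wS).
Qed.

End CrossBifixFree.

Definition max_cross_bifix_free (n q : nat) : nat :=
  \max_(S : {set n.-tuple 'I_q} | cross_bifix_free S) #|S|.

(* Main.v *)
Require Import Defs.
From mathcomp Require Import all_boot all_order all_algebra.

Import Order.TTheory GRing.Theory Num.Theory.
Local Open Scope ring_scope.

(** Place a codeword [u] of length [n] at each of the [2n - 1] positions of a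
    cyclic word of length [2n - 1] and fill the other [n - 1] letters
    arbitrarily.  Two occurrences of codewords at different positions of a
    cyclic word overlap, because [2n > 2n - 1], and the overlap is a prefix of
    one codeword and a suffix of the other.  Hence all the words obtained are
    distinct, so [#|S| * (2n - 1) * q ^ (n - 1) <= q ^ (2n - 1)]. *)

Section CyclicPlacement.

Variables (T : finType) (n : nat) (S : {set n.-tuple T}).
Hypothesis cbfS : cross_bifix_free S.

(** Otherwise [drop d w], of length [n - d], would be a suffix of [w] and also a prefix of [u];
    [0 < d < n] makes it proper and nonempty. *)
Lemma cross_bifix_free_rot_neq (u w : n.-tuple T) (t s : seq T) (d : nat) :
  u \in S -> w \in S -> (0 < d < n)%N -> u ++ t <> rot d (w ++ s).
Proof.
move=> uS wS /andP[d_gt0 lt_dn] eq_rot.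
have szd : size (drop d w) = (n - d)%N by rewrite size_drop size_tuple.
apply: (elimT (cross_bifix_freeP S) cbfS u w (drop d w) uS wS).
rewrite /proper_prefix /proper_suffix -size_eq0 szd !size_tuple.
rewrite -lt0n subn_gt0 lt_dn ltn_subrL d_gt0 (leq_ltn_trans _ lt_dn) //=.
split; last by apply/suffixP; exists (take d w); rewrite cat_take_drop.
rewrite prefixE szd; apply/eqP.
have -> : take (n - d) u = take (n - d) (u ++ t).
  by rewrite takel_cat // size_tuple leq_subr.
by rewrite eq_rot /rot drop_cat size_tuple lt_dn -catA -szd take_size_cat.
Qed.

Definition place (x : n.-tuple T * 'I_(n + n.-1) * n.-1.-tuple T) :
    (n + n.-1).-tuple T :=
  let: (u, i, t) := x in [tuple of rot i [tuple of u ++ t]].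

Lemma place_inj :
  {in setX (setX S [set: 'I_(n + n.-1)]) [set: n.-1.-tuple T] &, injective place}.
Proof.
move=> [[u i] t] [[w j] s]; rewrite !inE !andbT /= => uS wS /(congr1 val) /=.
wlog le_ij : u i t w j s uS wS / (i <= j)%N => [IH|].
  case/orP: (leq_total i j) => [le_ij|le_ji] e; first exact: IH e.
  by apply/esym/(IH w j s u i t).
have sz (a : n.-tuple T) (b : n.-1.-tuple T) : size (a ++ b) = (n + n.-1)%N.
  by rewrite size_cat !size_tuple.
(* Undoing [rot i] on both sides leaves [u ++ t = rot (j - i) (w ++ s)]. *)
rewrite -{1}(subnKC le_ij) rotD ?sz ?subnKC ?(ltnW (ltn_ord j)) //.
move/rot_inj; case: (posnP (j - i)) => [d0|d_gt0].
  have -> : i = j by apply/val_inj/eqP; rewrite eqn_leq le_ij -subn_eq0 d0.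
  rewrite subnn rot0 => /eqP; rewrite eqseq_cat ?size_tuple //.
  by case/andP=> /eqP/val_inj-> /eqP/val_inj->.
have lt_dm : (j - i < n + n.-1)%N := leq_ltn_trans (leq_subr i j) (ltn_ord j).
case: (ltnP (j - i) n) => [lt_dn|le_nd] eq_rot.
  by case: (cross_bifix_free_rot_neq u w t s (j - i)%N uS wS _ eq_rot); rewrite d_gt0.
(* For a shift [d >= n], the overlap lies across the other end of the cycle: rotating back exchanges
   [u] and [w] and gives the shift [2n - 1 - d], which lies strictly between [0] and [n]. *)
have /= eq_rot' := esym (congr1 (rotr (j - i)%N) eq_rot).
rewrite rotK /rotr sz in eq_rot'.
case: (cross_bifix_free_rot_neq w u s t _ wS uS _ eq_rot').
rewrite subn_gt0 lt_dm ltn_subLR ?(ltnW lt_dm) //.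
have m_gt0 : (0 < n + n.-1)%N := leq_ltn_trans (leq0n j) (ltn_ord j).
have n_gt0 : (0 < n)%N by case: (n) m_gt0.
by rewrite -addnS prednK // leq_add2r.
Qed.

Lemma card_cross_bifix_free : (#|S| * (n + n.-1) <= #|T| ^ n)%N.
Proof.
(* An empty alphabet is treated apart, since the count below cancels [#|T| ^ n.-1]. *)
have [T0|T_gt0] := posnP #|T|.
  case: (posnP n) => [n0|n_gt0].
    have -> : (n + n.-1 = 0)%N by rewrite n0.
    by rewrite muln0.
  by have := max_card (mem S); rewrite card_tuple T0 exp0n // leqn0 => /eqP->.
rewrite -(@leq_pmul2r (#|T| ^ n.-1)) ?expn_gt0 ?T_gt0 // -expnD.
have := leq_trans (eq_leq (esym (card_in_imset place_inj))) (max_card _).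
by rewrite !cardsX !cardsT card_ord !card_tuple.
Qed.

End CyclicPlacement.

Theorem mainTheorem5 (q n : nat) (hq : (2 <= q)%N) (hn : (1 <= n)%N) :
  (max_cross_bifix_free n q)%:R <= q%:R ^+ n / (2 * n%:R - 1) :> rat.
Proof.
have -> : 2 * n%:R - 1 = (n + n.-1)%:R :> rat.
  apply/eqP; rewrite subr_eq natr1 -natrM eqr_nat.
  by rewrite -addnS prednK // addnn mul2n.
rewrite ler_pdivlMr ?ltr0n ?addn_gt0 ?hn // -natrX -natrM ler_nat.
(* Integer division isolates the maximum, so that each code can be bounded separately. *)
rewrite -leq_divRL ?addn_gt0 ?hn //; apply/bigmax_leqP => S cbfS.
rewrite leq_divRL ?addn_gt0 ?hn //.
by have := card_cross_bifix_free _ _ _ cbfS; rewrite card_ord.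
Qed.
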